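(* Let $V_R$ be a right quasigroup and let $S\subseteq V$ be a subset. (a) If $R_vR_sR_v^{-1}\in R(S)$ for all $v\in V$ and $s\in S$, then $(\Gamma(V_R,S),R)$ is a marked digraph realizing $V_R$. (b) If $R_vR_sR_v^{-1}\in R(S)\cup R(S)^{-1}$ for all $v\in V$ and $s\in S$, then $(\Gamma_{\mathrm{und}}(V_R,S),R)$ is a marked graph realizing $V_R$. (c) In particular, if $V_R$ is a rack and $\Gamma$ is its full Cayley digraph $\Gamma(V_R,V)$ or its full Cayley graph $\Gamma_{\mathrm{und}}(V_R,V)$, then $(\Gamma,R)$ realizes $V_R$.
   Context: A right quasigroup $V_R$ is a pair $(V,R)$ where $V$ is a set and $R:V\to S_V$, $v\mapsto R_v$, is a function to the group of permutations of $V$. It is a rack if $R_vR_w=R_{R_v(w)}R_v$ for all $v,w\in V$. Write $R(S)=\{R_s\mid s\in S\}$ and $R(S)^{-1}=\{R_s^{-1}\mid s\in S\}$. A digraph is a pair $(V,E)$ with $E\subseteq V\times V$ (loops allowed). A graph is a simple undirected graph: $E$ is a set of unordered pairs $\{v,w\}\subseteq V$ with $v\ne w$. No finiteness is assumed. An automorphism of a digraph (resp. graph) $\Gamma=(V,E)$ is a permutation $\varphi$ of $V$ such that $(\varphi(v),\varphi(w))\in E$ for all $(v,w)\in E$ (resp. $\{\varphi(v),\varphi(w)\}\in E$ for all $\{v,w\}\in E$); $\operatorname{Aut}\Gamma$ is the set of automorphisms of $\Gamma$. A marking of $\Gamma$ is a function $R:V\to\operatorname{Aut}\Gamma$; then $(\Gamma,R)$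 is called a marked (di)graph and it realizes the right quasigroup $(V,R)$. The Cayley digraph $\Gamma(V_R,S)$ is the digraph with vertex set $V$ and edge set $\{(v,R_s(v))\mid v\in V,\ s\in S\}$. The Cayley graph $\Gamma_{\mathrm{und}}(V_R,S)$ is its underlying simple undirected graph, with edges $\{v,R_s(v)\}$ for $v\in V$, $s\in S$ with $R_s(v)\neq v$. They are called full when $S=V$. *)

(* Defs.v *)
From HB Require Import structures.
From mathcomp Require Import all_boot.
From mathcomp Require Import boolp classical_sets.

Set Implicit Arguments.
Unset Strict Implicit.
Unset Printing Implicit Defensive.

Local Open Scope classical_set_scope.
Local Open Scope group_scope.

(* The symmetric group S_V of an arbitrary, possibly infinite, type V.
   Unlike in {perm T}, the product is the usual composition of functions:
   (f * g) x = f (g x). *)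
Record permutation (V : Type) := Permutation {
  perm_fun :> V -> V;
  perm_finv : V -> V;
  perm_funK : cancel perm_fun perm_finv;
  perm_finvK : cancel perm_finv perm_fun
}.

Section SymmetricGroup.
Variable V : Type.
Implicit Types f g h : permutation V.

Lemma permutation_ext f g : f =1 g -> f = g.
Proof.
case: f g => [f f' fK f'K] [g g' gK g'K] /= /funext fg; subst g.
have f'g' : f' = g' by apply/funext => x; rewrite -{1}(g'K x) fK.
by subst g'; congr Permutation; exact: Prop_irrelevance.
Qed.

Definition permutation_one : permutation V :=
  @Permutation V id id (fun=> erefl) (fun=> erefl).

Definition permutation_mul f g : permutation V :=
  Permutation (can_comp (@perm_funK V f) (@perm_funK V g))
              (can_comp (@perm_finvK V g) (@perm_finvK V f)).

Definition permutation_inv f : permutation V :=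
  Permutation (@perm_finvK V f) (@perm_funK V f).

Lemma permutation_mulA : associative permutation_mul.
Proof. by move=> f g h; exact: permutation_ext. Qed.

Lemma permutation_mul1 : left_id permutation_one permutation_mul.
Proof. by move=> f; exact: permutation_ext. Qed.

Lemma permutation_mulr1 : right_id permutation_one permutation_mul.
Proof. by move=> f; exact: permutation_ext. Qed.

Lemma permutation_mulV :
  left_inverse permutation_one permutation_inv permutation_mul.
Proof. by move=> f; apply: permutation_ext => x /=; rewrite perm_funK. Qed.

Lemma permutation_mulrV :
  right_inverse permutation_one permutation_inv permutation_mul.
Proof. by move=> f; apply: permutation_ext => x /=; rewrite perm_finvK. Qed.

HB.instance Definition _ := gen_eqMixin (permutation V).
HB.instance Definition _ := gen_choiceMixin (permutation V).
HB.instance Definition _ := isGroup.Build (permutation V)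
  permutation_mulA permutation_mul1 permutation_mulr1
  permutation_mulV permutation_mulrV.

End SymmetricGroup.

Record right_quasigroup (V : Type) := RightQuasigroup {
  rq_perm :> V -> permutation V
}.

Definition rack (V : Type) (R : right_quasigroup V) : Prop :=
  forall v w : V, R v * R w = R (R v w) * R v.

Record digraph (V : Type) := Digraph { arcs : set (V * V) }.

Record graph (V : Type) := Graph {
  edges : set (set V);
  edgesP : forall e, edges e -> exists v w : V, v <> w /\ e = [set v; w]
}.

(* Only preservation of edges is required, not reflection: on an infinite
   (di)graph the inverse of an automorphism need not be an automorphism. *)
Definition digraph_Aut (V : Type) (G : digraph V) : set (permutation V) :=
  [set f | forall v w, arcs G (v, w) -> arcs G (f v, f w)].

Definition graph_Aut (V : Type) (G : graph V) : set (permutation V) :=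
  [set f : permutation V |
    forall v w, edges G [set v; w] -> edges G [set f v; f w]].

Definition marked_digraph (V : Type) (G : digraph V)
    (R : V -> permutation V) : Prop :=
  forall v, digraph_Aut G (R v).

Definition marked_graph (V : Type) (G : graph V)
    (R : V -> permutation V) : Prop :=
  forall v, graph_Aut G (R v).

Definition digraph_realizes (V : Type) (G : digraph V)
    (R : V -> permutation V) (Q : right_quasigroup V) : Prop :=
  marked_digraph G R /\ RightQuasigroup R = Q.

Definition graph_realizes (V : Type) (G : graph V)
    (R : V -> permutation V) (Q : right_quasigroup V) : Prop :=
  marked_graph G R /\ RightQuasigroup R = Q.

Definition underlying_edges (V : Type) (G : digraph V) : set (set V) :=
  [set e | exists v w, [/\ arcs G (v, w), v <> w & e = [set v; w]]].

Lemma underlying_edgesP (V : Type) (G : digraph V) (e : set V) :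
  underlying_edges G e -> exists v w : V, v <> w /\ e = [set v; w].
Proof. by move=> [v [w [_ vw ->]]]; exists v, w. Qed.

Definition underlying_graph (V : Type) (G : digraph V) : graph V :=
  Graph (@underlying_edgesP V G).

Definition Cayley_digraph (V : Type) (R : right_quasigroup V) (S : set V) :
    digraph V :=
  Digraph [set e | exists v s, S s /\ e = (v, R s v)].

Definition Cayley_graph (V : Type) (R : right_quasigroup V) (S : set V) :
    graph V :=
  underlying_graph (Cayley_digraph R S).

Definition full_Cayley_digraph (V : Type) (R : right_quasigroup V) :
    digraph V := Cayley_digraph R setT.

Definition full_Cayley_graph (V : Type) (R : right_quasigroup V) :
    graph V := Cayley_graph R setT.

(* Main.v *)
(* Conjugation rewrites R_v(R_s(x)) as (R_v R_s R_v^-1)(R_v(x)), so R_v sends the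
   arc from x to R_s(x) to an arc from R_v(x) when R_v R_s R_v^-1 is in R(S), and
   to a reversed arc when it is in R(S)^-1.  In a rack, R_v R_s R_v^-1 is
   R_{R_v(s)}, so R(V) is closed under conjugation. *)
Require Import Defs.
From mathcomp Require Import all_boot.
From mathcomp Require Import boolp classical_sets.

Local Open Scope classical_set_scope.
Local Open Scope group_scope.

Section CayleyAutomorphisms.
Variable V : Type.
Implicit Types (G : digraph V) (f : permutation V) (S : set V).

Lemma digraph_Aut_Cayley (R : right_quasigroup V) S f :
  (forall s, S s -> [set R t | t in S] (f * R s * f^-1)) ->
  digraph_Aut (Cayley_digraph R S) f.
Proof.
move=> fS _ _ [x [s [Ss [-> ->]]]]; have [t St Rt] := fS s Ss.
by exists (f x), t; split=> //; rewrite Rt /= perm_funK.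
Qed.

(** An undirected edge forgets the direction of its arc, so [f] may reverse arcs. Injectivity of [f]
    keeps the endpoints distinct, so no edge collapses to a loop. *)
Lemma graph_Aut_underlying G f :
  (forall a b, arcs G (a, b) -> arcs G (f a, f b) \/ arcs G (f b, f a)) ->
  graph_Aut (underlying_graph G) f.
Proof.
move=> fG v w [a [b [Gab ab vwE]]].
(* Equality of the pairs leaves open whether [v] is [a] or [b]; taking images under [f] avoids the
   case split. *)
have -> : [set f v; f w] = [set f a; f b].
  by rewrite -!image_set1 -!image_setU vwE.
have fab : f a <> f b by move/(can_inj (@perm_funK _ f)).
case: (fG _ _ Gab) => Gf; first by exists (f a), (f b).
by exists (f b), (f a); split; [|exact: nesym|rewrite setUC].
Qed.

Lemma graph_Aut_Cayley (R : right_quasigroup V) S f :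
  (forall s, S s ->
     ([set R t | t in S] `|` [set (R t)^-1 | t in S]) (f * R s * f^-1)) ->
  graph_Aut (Cayley_graph R S) f.
Proof.
move=> fS; apply: graph_Aut_underlying => _ _ [x [s [Ss [-> ->]]]].
(* In the inverse case [(R t)^-1] sends [f x] to [f (R s x)], so the arc labelled [t] starts at
   [f (R s x)] and ends at [f x]. *)
case: (fS s Ss) => -[t St Rt]; [left; exists (f x) | right; exists (f (R s x))];
  exists t; split=> //; first by rewrite Rt /= perm_funK.
have <- : (R t)^-1 (f x) = f (R s x) by rewrite Rt /= perm_funK.
by rewrite [R t _]perm_finvK.
Qed.

End CayleyAutomorphisms.

Lemma rack_conj (V : Type) (R : right_quasigroup V) (v w : V) :
  rack R -> R v * R w * (R v)^-1 = R (R v w).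
Proof. by move=> ->; rewrite mulgK. Qed.

Theorem corollary6p4 (V : Type) (R : V -> permutation V) (S : set V) :
  let V_R := RightQuasigroup R in
  let RS : set (permutation V) := [set R s | s in S] in
  let RSinv : set (permutation V) := [set (R s)^-1 | s in S] in
  [/\ (forall v s, S s -> RS (R v * R s * (R v)^-1)) ->
        digraph_realizes (Cayley_digraph V_R S) R V_R,
      (forall v s, S s -> (RS `|` RSinv) (R v * R s * (R v)^-1)) ->
        graph_realizes (Cayley_graph V_R S) R V_R
    & rack V_R ->
        digraph_realizes (full_Cayley_digraph V_R) R V_R /\
        graph_realizes (full_Cayley_graph V_R) R V_R].
Proof.
move=> V_R RS RSinv; split=> [RSP|RSP|rackR].
- by split=> // v; apply: digraph_Aut_Cayley; exact: RSP.
- by split=> // v; apply: graph_Aut_Cayley; exact: RSP.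
(* With all of [V] as connection set, the index [R v s] of the conjugate is always allowed, and arcs
   keep their direction. *)
- have conjR v s : [set R t | t in setT] (R v * R s * (R v)^-1).
    by exists (R v s); rewrite ?(rack_conj _ V_R v s rackR).
  split; split=> // v; first exact: digraph_Aut_Cayley.
  by apply: graph_Aut_Cayley => s _; left; exact: conjR.
Qed.
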